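(* Every instance of gGASP with $A=\{a,a_\emptyset\}$ (i.e., with exactly one non-void activity $a$) admits a core stable assignment; moreover, such an assignment can be computed in polynomial time.
   Context: An instance of the group activity selection problem with graph structure (gGASP) consists of: a finite set of players $N=\{1,\dots,n\}$; a finite set of activities $A=A^*\cup\{a_\emptyset\}$, where $A^*$ is the set of non-void activities and $a_\emptyset\notin A^*$ is the void activity; for each player $i$ a complete and transitive preference relation $\succeq_i$ on the set of alternatives $(A^*\times\{1,\dots,n\})\cup\{(a_\emptyset,1)\}$, with strict part $\succ_i$; and a set $L$ of edges making $(N,L)$ an undirected graph (arbitrary here). It is assumed that two alternatives can be compared under $\succeq_i$ in unit time. An assignment is a map $\pi:N\to A$. For $a\in A^*$ let $\pi^a=\{i\in N:\pi(i)=a\}$; let $\pi_i=\{j\in N:\pi(j)=\pi(i)\}$ if $\pi(i)\ne a_\emptyset$, and $\pi_i=\{i\}$ if $\pi(i)=a_\emptyset$. A coalition $S\subseteq N$ is feasible if it is connected in $(N,L)$; $\pi$ is feasible if $\pi_i$ is feasible for every $i\in N$. Outcomes of gGASP are feasible assignments. $\pi$ is individually rational if $(\pi(i),|\pi_i|)\succeq_i(a_\emptyset,1)$ for every $i\in N$. A coalition $S\subseteq N$ and activity $a\in A^*$ strongly block $\pi$ if $\pi^a\subseteq S$ and $(a,|S|)\succ_i(\pi(i),|\pi_i|)$ for all $i\in S$. A core stable assignment is a feasible assignment that is individually rational and for which there is no nonempty connected coalition $S$ and activity $a\in A^*$ that strongly block it. *)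

(* Defs.v *)
From mathcomp Require Import all_boot all_algebra.

Set Implicit Arguments.
Unset Strict Implicit.
Unset Printing Implicit Defensive.

(** ** Group activity selection on graphs *)

(* [A] is the set A* of non-void activities; the set of all activities is
   [option A], with [None] the void activity. *)
Definition is_alternative (n : nat) (A : finType) : pred (option A * nat) :=
  fun x => if x.1 is Some _ then 0 < x.2 <= n else x.2 == 1.

(* [pref I i x y] is "player i weakly prefers x to y"; its values outside
   [is_alternative] are never used. *)
Record gGASP (n : nat) (A : finType) := GGASP {
  pref : 'I_n -> rel (option A * nat);
  edge : rel 'I_n;
  pref_total : forall i, {in @is_alternative n A &, total (pref i)};
  pref_trans : forall i, {in @is_alternative n A & &, transitive (pref i)};
  edge_sym : symmetric edge;
  edge_irr : irreflexive edge
}.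

Section Stability.

Variables (n : nat) (A : finType) (I : gGASP n A).

Definition assignment := {ffun 'I_n -> option A}.

Implicit Types (pi : assignment) (S : {set 'I_n}) (a : A) (i : 'I_n).

Definition spref i : rel (option A * nat) :=
  fun x y => pref I i x y && ~~ pref I i y x.

Definition players_of pi a : {set 'I_n} := [set i | pi i == Some a].

Definition group_of pi i : {set 'I_n} :=
  if pi i is Some a then players_of pi a else [set i].

Definition alt_of pi i : option A * nat := (pi i, #|group_of pi i|).

(* Connectedness of the subgraph induced by [S]. *)
Definition connected_coalition S : Prop :=
  {in S &, forall i j,
    connect [rel x y | [&& x \in S, y \in S & edge I x y]] i j}.

Definition feasible pi : Prop := forall i, connected_coalition (group_of pi i).

Definition individually_rational pi : Prop :=
  forall i, pref I i (alt_of pi i) (None, 1).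

Definition strongly_blocks pi S a : Prop :=
  players_of pi a \subset S /\
  {in S, forall i, spref i (Some a, #|S|) (alt_of pi i)}.

Definition core_stable pi : Prop :=
  [/\ feasible pi, individually_rational pi &
      ~ exists S a,
          [/\ S != set0, connected_coalition S & strongly_blocks pi S a]].

End Stability.

(** ** Computation model

   A structured random access machine with unit-cost instructions, acting on
   registers (named by the program) and on an unbounded, indirectly addressed
   memory, all holding natural numbers.  The arithmetic is limited to addition
   and truncated subtraction, so that polynomial time in this uniform-cost
   model is the usual polynomial time.  The instance is read-only: [Edge] reads
   an entry of the adjacency matrix, and [Pref] compares two alternatives, each
   in unit time. *)

Inductive cmd : Type :=
| Const (x k : nat)             (* reg x := k                         *)
| Add (x y z : nat)             (* reg x := reg y + reg z             *)
| Sub (x y z : nat)             (* reg x := reg y - reg z             *)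
| Read (x y : nat)              (* reg x := memory (reg y)            *)
| Write (x y : nat)             (* memory (reg x) := reg y            *)
| Edge (x y z : nat)            (* reg x := [{reg y, reg z} is an edge]  *)
| Pref (x y a k b l : nat)      (* reg x := [(reg a, reg k) is weakly
                                   preferred to (reg b, reg l) by reg y] *)
| Seq (c d : cmd)
| If (x : nat) (c d : cmd)      (* c if reg x != 0, and d otherwise   *)
| While (x : nat) (c : cmd).    (* while reg x != 0 do c              *)

Record state := State { reg : nat -> nat; memory : nat -> nat }.

Definition set_reg (s : state) (x v : nat) : state :=
  State [eta reg s with x |-> v] (memory s).

Definition set_mem (s : state) (x v : nat) : state :=
  State (reg s) [eta memory s with x |-> v].

Section Machine.

Variables (n : nat) (A : finType) (I : gGASP n A).

(* Players are numbered from 0; the void activity has code 0 and the non-void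
   ones have codes 1, ..., #|A|. *)
Definition act_code (o : option A) : nat :=
  if o is Some a then (enum_rank a).+1 else 0.

Definition edge_query (u v : nat) : bool :=
  [exists i : 'I_n, exists j : 'I_n,
    [&& i == u :> nat, j == v :> nat & edge I i j]].

(* Queries that do not denote a player and two alternatives are answered
   negatively. *)
Definition pref_query (u a k b l : nat) : bool :=
  [exists i : 'I_n, exists x : option A, exists y : option A,
    [&& i == u :> nat, act_code x == a, act_code y == b,
        is_alternative n (x, k), is_alternative n (y, l) &
        pref I i (x, k) (y, l)]].

(* A configuration is the list of commands still to be executed, together with
   the current state; it is halted when that list is empty. *)
Definition step (cfg : seq cmd * state) : seq cmd * state :=
  let: (cs, s) := cfg in
  let r := reg s in
  if cs is c :: cs' then
    match c with
    | Const x k => (cs', set_reg s x k)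
    | Add x y z => (cs', set_reg s x (r y + r z))
    | Sub x y z => (cs', set_reg s x (r y - r z))
    | Read x y => (cs', set_reg s x (memory s (r y)))
    | Write x y => (cs', set_mem s (r x) (r y))
    | Edge x y z => (cs', set_reg s x (edge_query (r y) (r z)))
    | Pref x y a k b l =>
        (cs', set_reg s x (pref_query (r y) (r a) (r k) (r b) (r l)))
    | Seq c1 c2 => (c1 :: c2 :: cs', s)
    | If x c1 c2 => ((if r x != 0 then c1 else c2) :: cs', s)
    | While x c1 => (if r x != 0 then c1 :: c :: cs' else cs', s)
    end
  else cfg.

(* Registers 0 and 1 initially hold the numbers of players and of non-void
   activities. *)
Definition init_state : state :=
  State [fun _ => 0 with 0 |-> n, 1 |-> #|A|] (fun _ => 0).

(* Within [t] steps, [prog] halts having written, for each player [i], the code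
   of [pi i] in memory cell [i]. *)
Definition outputs_within (prog : cmd) (t : nat) (pi : assignment n A) : Prop :=
  let: (cs, s) := iter t step ([:: prog], init_state) in
  cs = [::] /\ forall i : 'I_n, memory s i = act_code (pi i).

End Machine.

(* Main.v *)
(** Call a connected coalition [S] viable if all its members strictly prefer
    (a, |S|) to being alone.  A viable [S] of maximum size, engaged in [a]
    while everybody else does nothing, is core stable: a blocking coalition
    contains [S], and by transitivity it is itself viable, hence equal to [S].
    To find [S], try the sizes k = n, ..., 1 and all starting players, and grow
    a connected coalition inside the set of players who strictly prefer (a, k)
    to being alone, until it has k members; n sweeps over all pairs of players
    suffice to exhaust a connected component of that set. *)

Require Import Defs.
From mathcomp Require Import all_boot all_algebra.
From mathcomp Require Import zify.

Set Implicit Arguments.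
Unset Strict Implicit.
Unset Printing Implicit Defensive.

Import GRing.Theory.

(* A loop is charged for [n] rounds, which bounds the running time only of
   programs whose loops are all of the form [For] below. *)
Fixpoint time_poly (c : cmd) : {poly nat} :=
  match c with
  | Seq c d | If _ c d => (time_poly c + time_poly d + 1)%R
  | While _ c => ('X * (time_poly c + 1) + 1)%R
  | _ => 1%R
  end.

Fixpoint writes (c : cmd) : seq nat :=
  match c with
  | Const x _ | Add x _ _ | Defs.Sub x _ _ | Read x _ | Edge x _ _
  | Pref x _ _ _ _ _ => [:: x]
  | Write _ _ => [::]
  | Seq c d | If _ c d => writes c ++ writes d
  | While _ c => writes c
  end.

(** * Total correctness and running time of programs *)

Section Execution.

Variables (n : nat) (A : finType) (I : gGASP n A).

(** [t] and [s'] are chosen before the pending commands [cs], which makes runs compose under [Seq].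
    This is total correctness together with a time bound. *)
Definition wp (c : cmd) (Q : state -> Prop) (s : state) : Prop :=
  exists t s',
    [/\ t <= (time_poly c).[n]%R,
        forall cs, iter t (step I) (c :: cs, s) = (cs, s') & Q s'].

(** Every pending command is a piece of an initial one, so no new register can become a target; the
    induction has to carry this along with the value of [x]. *)
Lemma iter_step_frame x t cs s :
    x \notin flatten [seq writes c | c <- cs] ->
  let cfg := iter t (step I) (cs, s) in
  x \notin flatten [seq writes c | c <- cfg.1] /\ reg cfg.2 x = reg s x.
Proof.
move=> Hx; elim: t => [|t] //=.
case: (iter t _ _) => [[|c cs'] s'] //= [].
rewrite mem_cat negb_or => /andP[Hc Hcs] <-.
case: c Hc => //=.
- by move=> y k; rewrite inE => /negPf->.
- by move=> y z w; rewrite inE => /negPf->.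
- by move=> y z w; rewrite inE => /negPf->.
- by move=> y z; rewrite inE => /negPf->.
- by move=> y z w; rewrite inE => /negPf->.
- by move=> y z w k b l; rewrite inE => /negPf->.
- by move=> c d; rewrite !mem_cat !negb_or => /andP[-> ->].
- by move=> y c d; rewrite !mem_cat !negb_or => /andP[Hc Hd]; case: ifP; rewrite ?Hc ?Hd.
- by move=> y c Hc; case: ifP; rewrite /= ?mem_cat ?negb_or ?Hc ?Hcs.
Qed.

Lemma wp_frame c Q s :
    wp c Q s ->
  wp c (fun s' => Q s' /\ forall x, x \notin writes c -> reg s' x = reg s x) s.
Proof.
case=> t [s' [tle run Qs']]; exists t, s'; split=> //; split=> // x xc.
have := @iter_step_frame x t [:: c] s; rewrite run /= cats0.
by case/(_ xc).
Qed.

Lemma wp_mono c (Q Q' : state -> Prop) s :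
  (forall s', Q s' -> Q' s') -> wp c Q s -> wp c Q' s.
Proof. by move=> QQ' [t [s' [? ? ?]]]; exists t, s'; split=> //; apply: QQ'. Qed.

Lemma wp_const x k (Q : state -> Prop) s :
  Q (set_reg s x k) -> wp (Const x k) Q s.
Proof. by move=> Qs; exists 1, (set_reg s x k); rewrite /= hornerC. Qed.

Lemma wp_add x y z (Q : state -> Prop) s :
  Q (set_reg s x (reg s y + reg s z)) -> wp (Add x y z) Q s.
Proof. by move=> Qs; exists 1; eexists; split; [rewrite hornerC|done|]. Qed.

Lemma wp_sub x y z (Q : state -> Prop) s :
  Q (set_reg s x (reg s y - reg s z)) -> wp (Defs.Sub x y z) Q s.
Proof. by move=> Qs; exists 1; eexists; split; [rewrite hornerC|done|]. Qed.

Lemma wp_read x y (Q : state -> Prop) s :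
  Q (set_reg s x (memory s (reg s y))) -> wp (Read x y) Q s.
Proof. by move=> Qs; exists 1; eexists; split; [rewrite hornerC|done|]. Qed.

Lemma wp_write x y (Q : state -> Prop) s :
  Q (set_mem s (reg s x) (reg s y)) -> wp (Write x y) Q s.
Proof. by move=> Qs; exists 1; eexists; split; [rewrite hornerC|done|]. Qed.

Lemma wp_edge x y z (Q : state -> Prop) s :
  Q (set_reg s x (edge_query I (reg s y) (reg s z))) -> wp (Edge x y z) Q s.
Proof. by move=> Qs; exists 1; eexists; split; [rewrite hornerC|done|]. Qed.

Lemma wp_pref x y a k b l (Q : state -> Prop) s :
    Q (set_reg s x
         (pref_query I (reg s y) (reg s a) (reg s k) (reg s b) (reg s l))) ->
  wp (Pref x y a k b l) Q s.
Proof. by move=> Qs; exists 1; eexists; split; [rewrite hornerC|done|]. Qed.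

Lemma wp_seq c d Q s : wp c (wp d Q) s -> wp (Seq c d) Q s.
Proof.
case=> t [s1 [tle run [t' [s2 [tle' run' Qs]]]]].
exists (t' + t).+1, s2; split=> // [|cs].
  by rewrite /= !hornerD hornerC; lia.
by rewrite iterSr iterD /= run run'.
Qed.

Lemma wp_if x c d Q s :
  (reg s x != 0 -> wp c Q s) -> (reg s x = 0 -> wp d Q s) -> wp (If x c d) Q s.
Proof.
move=> Hc Hd; case: (eqVneq (reg s x) 0) => [x0|x0].
  have [t [s1 [tle run Qs]]] := Hd x0.
  exists t.+1, s1; split=> // [|cs].
    by rewrite /= !hornerD hornerC; lia.
  by rewrite iterSr /= x0 run.
have [t [s1 [tle run Qs]]] := Hc x0.
exists t.+1, s1; split=> // [|cs].
  by rewrite /= !hornerD hornerC; lia.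
by rewrite iterSr /= x0 run.
Qed.

(* Register 1 holds the number of non-void activities, which is 1 here. *)
Definition For (x : nat) (c : cmd) : cmd := While x (Seq (Defs.Sub x x 1) c).

(** The counter is decremented before the body runs, so the body sees n - 1, ..., 0. The index of
    [Inv] is the number of rounds left. *)
Lemma wp_for x c (Inv : nat -> state -> Prop) s :
    x \notin writes c -> 1 \notin x :: writes c ->
    reg s 1 = 1 -> reg s x = n ->
    (forall m s', m < n ->
       (forall y, y \notin x :: writes c -> reg s' y = reg s y) ->
       Inv m.+1 s' -> wp c (Inv m) (set_reg s' x m)) ->
    Inv n s ->
  wp (For x c) (Inv 0) s.
Proof.
move=> xc c1 s1 sx body Ins.
pose fr s' := forall y, y \notin x :: writes c -> reg s' y = reg s y.
(* Each of the [m] rounds left costs a test and a run of the body; the final [1] pays for the test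
   that fails. At [m = n] this is [time_poly] of the loop. *)
suff loop m s' : m <= n -> fr s' -> reg s' x = m -> Inv m s' ->
    exists t s'', [/\ t <= m * ((time_poly (Seq (Defs.Sub x x 1) c)).[n]%R + 1) + 1,
      forall cs, iter t (step I) (For x c :: cs, s') = (cs, s'') & Inv 0 s''].
  have [t [s' [tle run I0]]] := loop n s (leqnn _) (fun _ _ => erefl) sx Ins.
  exists t, s'; split=> //; move: tle.
  by rewrite [time_poly (For _ _)]/= !(hornerD, hornerM, hornerX, hornerC).
elim: m s' => [|m IHm] s' mn frs sx' Im.
  by exists 1, s'; split=> // cs; rewrite /= sx'.
have wpb : wp (Seq (Defs.Sub x x 1) c) (fun s'' => Inv m s'' /\ fr s'' /\ reg s'' x = m) s'.
  apply: wp_seq; apply: wp_sub.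
  rewrite sx' frs // s1 subn1 /=.
  apply: wp_mono (wp_frame (body m s' mn frs Im)) => s'' [Ims fr''].
  split=> //; split=> [y|].
    move=> yc; move: (yc); rewrite inE negb_or => /andP[yx yc'].
    by rewrite fr'' //= (negPf yx) frs.
  by rewrite fr'' //= eqxx.
have [t [s2 [tle run [Im2 [fr2 sx2]]]]] := wpb.
have [t' [s3 [tle' run' I0]]] := IHm s2 (ltnW mn) fr2 sx2 Im2.
exists (t' + t).+1, s3; split=> // [|cs].
  by rewrite mulSn; lia.
by rewrite iterSr iterD /= sx' /= run run'.
Qed.

End Execution.

(** * Viable coalitions and core stability *)

Section Stable.

Variables (n : nat) (A : finType) (I : gGASP n A) (a : A).

Definition fans k : {set 'I_n} :=
  [set i | spref I i (Some a, k) (None, 1)].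

Definition viable (S : {set 'I_n}) : Prop :=
  connected_coalition I S /\ S \subset fans #|S|.

Definition coalition_assignment (S : {set 'I_n}) : assignment n A :=
  [ffun i => if i \in S then Some a else None].

Lemma players_of_coalition S : players_of (coalition_assignment S) a = S.
Proof. by apply/setP=> i; rewrite inE ffunE; case: ifP => //; rewrite eqxx. Qed.

Lemma alt_of_coalition S i :
  alt_of (coalition_assignment S) i = if i \in S then (Some a, #|S|) else (None, 1).
Proof.
rewrite /alt_of /group_of ffunE.
by case: ifP => _; rewrite ?players_of_coalition ?cards1.
Qed.

Lemma core_stable_coalition S :
    (forall b : A, b = a) -> viable S ->
    (forall T, viable T -> #|T| <= #|S|) ->
  core_stable I (coalition_assignment S).
Proof.
move=> Aa [Sc Sfan] Smax; split.
- move=> i; rewrite /group_of ffunE; case: ifP => _.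
    by rewrite players_of_coalition.
  by move=> j k; rewrite !inE => /eqP-> /eqP->; apply: connect0.
- move=> i; rewrite alt_of_coalition; case: ifP => [/(subsetP Sfan)|_].
    by rewrite inE => /andP[].
  have := @pref_total _ _ I i (None, 1) (None, 1) isT isT.
  by rewrite orbb.
case=> T [b [T0 Tc []]]; rewrite (Aa b) players_of_coalition => ST Tpref.
(* Transitivity is only available on genuine alternatives, hence for sizes between 1 and [n]. *)
have altT (U : {set 'I_n}) i : i \in U -> (Some a, #|U|) \in @is_alternative n A.
  move=> iU; rewrite unfold_in /is_alternative /=; apply/andP; split.
    by apply/card_gt0P; exists i.
  by rewrite -[leqRHS]card_ord; apply: max_card.
have Tviable : viable T.
  split=> //; apply/subsetP=> i iT; rewrite inE.
  have := Tpref i iT; rewrite alt_of_coalition; case: ifP => // iS /andP[p1 p2].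
  have := subsetP Sfan i iS; rewrite inE => /andP[p3 p4].
  rewrite /spref (pref_trans _ _ _ p1 p3) ?(altT _ i) //=.
  (* If being alone were weakly preferred to [(Some a, #|T|)], so would be [(Some a, #|S|)], by way
     of being alone, against [p2]. *)
  apply: contra p2 => p5; apply: (pref_trans _ _ _ p3 p5); rewrite ?(altT _ i) //.
have /eqP eST : S == T by rewrite eqEcard ST (Smax _ Tviable).
have [i iT] := set0Pn _ T0.
have := Tpref i iT; rewrite alt_of_coalition eST iT /spref.
by case: (pref I i _ _).
Qed.

(** * Growing a connected coalition *)

Definition add_fan k (S : {set 'I_n}) (j : 'I_n) : {set 'I_n} :=
  if (#|S| < k) && (j \in fans k) then j |: S else S.

Definition grow_along k (i : 'I_n) (S : {set 'I_n}) (j : 'I_n) : {set 'I_n} :=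
  if (i \in S) && edge I i j then add_fan k S j else S.

(** Reversed because the loops of the program count down: the folds follow its execution exactly. *)
Definition grow_from k (S : {set 'I_n}) (i : 'I_n) : {set 'I_n} :=
  foldl (grow_along k i) S (rev (enum 'I_n)).

Definition grow k (S : {set 'I_n}) : {set 'I_n} :=
  foldl (grow_from k) S (rev (enum 'I_n)).

Definition explore k (v : 'I_n) : {set 'I_n} :=
  iter n (grow k) (add_fan k set0 v).

Lemma foldl_invariant (T U : Type) (P : T -> Prop) (F : T -> U -> T) S l :
  (forall S i, P S -> P (F S i)) -> P S -> P (foldl F S l).
Proof. by move=> FP; elim: l S => //= i l IHl S PS; apply/IHl/FP. Qed.

Lemma foldl_extensive (F : {set 'I_n} -> 'I_n -> {set 'I_n}) l (S : {set 'I_n}) :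
  (forall (T : {set 'I_n}) j, T \subset F T j) -> S \subset foldl F S l.
Proof.
move=> Fext; apply: (foldl_invariant (P := fun T : {set 'I_n} => S \subset T)) => // T i ST.
exact: subset_trans ST _.
Qed.

(** [T] is the stage of the fold just before [i] is processed; later steps only enlarge the set, so
    what this step adds survives. *)
Lemma foldl_visit (F : {set 'I_n} -> 'I_n -> {set 'I_n}) l (S : {set 'I_n}) i :
    (forall (T : {set 'I_n}) j, T \subset F T j) -> i \in l ->
  exists2 T : {set 'I_n}, S \subset T & F T i \subset foldl F S l.
Proof.
move=> Fext; elim: l S => //= j l IHl S; rewrite inE => /predU1P[->|/(IHl (F S j))[T ST ?]].
  by exists S => //; apply: foldl_extensive.
by exists T => //; apply: subset_trans ST.
Qed.

Lemma add_fan_extensive k (S : {set 'I_n}) j : S \subset add_fan k S j.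
Proof. by rewrite /add_fan; case: ifP => // _; apply: subsetU1. Qed.

Lemma grow_along_extensive k i (S : {set 'I_n}) j : S \subset grow_along k i S j.
Proof. by rewrite /grow_along; case: ifP => // _; apply: add_fan_extensive. Qed.

Lemma grow_from_extensive k (S : {set 'I_n}) i : S \subset grow_from k S i.
Proof. exact/foldl_extensive/grow_along_extensive. Qed.

Lemma grow_extensive k (S : {set 'I_n}) : S \subset grow k S.
Proof. exact/foldl_extensive/grow_from_extensive. Qed.

Lemma iter_grow_extensive k (S : {set 'I_n}) p q :
  p <= q -> iter p (grow k) S \subset iter q (grow k) S.
Proof.
move/subnK <-; elim: (q - p) => // d IHd.
exact: subset_trans IHd (grow_extensive _ _).
Qed.

(* When the growth was not stopped by the size bound, the pair (i, j) has been
   visited at a moment when [i] already belonged to the coalition. *)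
Lemma grow_neighbour k (S : {set 'I_n}) i j :
    i \in S -> edge I i j -> j \in fans k -> #|grow k S| < k ->
  j \in grow k S.
Proof.
move=> iS ij jk.
have [T1 ST1 /subset_trans sub1] :=
  foldl_visit S (@grow_from_extensive k) (i := i) (l := rev (enum 'I_n))
    ltac:(by rewrite mem_rev mem_enum).
have [T2 ST2 sub2] :=
  foldl_visit T1 (@grow_along_extensive k i) (i := j) (l := rev (enum 'I_n))
    ltac:(by rewrite mem_rev mem_enum).
have {sub1 sub2} := subset_trans sub2 (sub1 _ (subxx _)).
rewrite -/(grow k S) /grow_along (subsetP ST2) ?(subsetP ST1) // ij /= => sub lek.
apply: (subsetP sub); rewrite /add_fan jk.
(* The cap [k] was not active on this visit, since the coalition of that moment lies inside the
   final one. *)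
by rewrite (leq_ltn_trans (subset_leq_card (subset_trans (add_fan_extensive _ _ _) sub)) lek) setU11.
Qed.

Definition induced (S : {set 'I_n}) : rel 'I_n :=
  [rel x y | [&& x \in S, y \in S & edge I x y]].

(** Each round advances at least one edge along the path. The size bound passes down to earlier
    rounds because rounds only add members. *)
Lemma explore_path k (T : {set 'I_n}) v p :
    T \subset fans k -> path (induced T) v p -> v \in T ->
    #|iter (size p) (grow k) (add_fan k set0 v)| < k ->
  last v p \in iter (size p) (grow k) (add_fan k set0 v).
Proof.
move=> Tk; elim/last_ind: p => [_ vT|p w IHp].
  by rewrite /= /add_fan cards0 (subsetP Tk) // andbT; case: k Tk => //= k _; rewrite setU11.
rewrite rcons_path last_rcons size_rcons => /andP[vp /and3P[uT wT uw]] vT /= ltk.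
apply: (@grow_neighbour k _ (last v p) w) => //; last exact: (subsetP Tk).
apply: IHp => //; apply: leq_ltn_trans ltk; apply: subset_leq_card.
exact: grow_extensive.
Qed.

(** If fewer than [k] players were reached, the cap never intervened, so paths inside [T] lead to
    all of [T], which is too large. *)
Lemma explore_complete k (T : {set 'I_n}) v :
    connected_coalition I T -> T \subset fans k -> v \in T -> k <= #|T| ->
  k <= #|explore k v|.
Proof.
move=> Tc Tk vT kT; rewrite leqNgt; apply/negP => ltk.
suff /subset_leq_card : T \subset explore k v by lia.
apply/subsetP=> w wT.
(* A path without repetition has fewer than [n] edges, so [n] rounds cover it. *)
have /connectP[q /shortenP[p vp p_uniq _] ->] := Tc v w vT wT.
have szp : size p <= n.
  have := max_card (mem (v :: p)); rewrite card_ord (card_uniqP p_uniq) /=.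
  exact: ltnW.
have sub := iter_grow_extensive k (add_fan k set0 v) szp.
apply: (subsetP sub); apply: (@explore_path k T) => //.
exact: leq_ltn_trans (subset_leq_card sub) ltk.
Qed.

Lemma connected_setU1 (S : {set 'I_n}) i j :
    connected_coalition I S -> i \in S -> edge I i j ->
  connected_coalition I (j |: S).
Proof.
move=> Sc iS ij.
have e_sym : connect_sym (induced (j |: S)).
  by apply: sym_connect_sym => x y; rewrite /induced /= edge_sym andbCA.
have to_i x : x \in j |: S -> connect (induced (j |: S)) i x.
  rewrite !inE => /predU1P[->|xS].
    by apply: connect1; rewrite /induced /= ij !inE eqxx iS orbT.
  apply: connect_sub (Sc i x iS xS) => y z /and3P[yS zS yz].
  by apply: connect1; rewrite /induced /= !inE yS zS !orbT.
by move=> x y /to_i ix /to_i; apply: connect_trans; rewrite -/(induced _) e_sym.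
Qed.

Definition partial k (S : {set 'I_n}) : Prop :=
  [/\ connected_coalition I S, S \subset fans k & #|S| <= k].

(** The reason why [j |: S] is connected is left to the caller: an edge during the growth, being a
    singleton at the start. *)
Lemma add_fan_partial k (S : {set 'I_n}) j :
    S \subset fans k -> #|S| <= k -> connected_coalition I S ->
    connected_coalition I (j |: S) ->
  partial k (add_fan k S j).
Proof.
move=> Sk lek Sc jSc; rewrite /add_fan; case: ifP => // /andP[ltk jk].
split=> //; first by rewrite subUset sub1set jk.
by rewrite cardsU1; case: (_ \notin _) => //; lia.
Qed.

Lemma explore_partial k v : partial k (explore k v).
Proof.
suff grown m : partial k (iter m (grow k) (add_fan k set0 v)) by apply: grown.
elim: m => [|m IHm] /=; last first.
  apply: foldl_invariant IHm => S i; apply: foldl_invariant => {}S j PS.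
  rewrite /grow_along; case: ifP => // /andP[iS ij]; case: (PS) => Sc Sk lek.
  by apply: add_fan_partial => //; apply: connected_setU1 ij.
apply: add_fan_partial; rewrite ?sub0set ?cards0 //.
  by move=> x y; rewrite inE.
by move=> x y; rewrite setU0 !inE => /eqP-> /eqP->; apply: connect0.
Qed.

End Stable.

(** * The program *)

Local Notation "c ;; d" := (Seq c d) (at level 80, right associativity).

(* Register 0 holds [n], 1 holds #|A| = 1 (hence also the code of [a]), and 2
   holds 0 (hence also the code of the void activity); 10 holds the target
   size [k], 4 the number of players still missing from the coalition being
   grown, and 9 is a scratch register. *)
Definition skip : cmd := Const 9 0.

Definition loop (x : nat) (c : cmd) : cmd := Add x 0 2 ;; For x c.

(** Strictness takes two queries. Register 1 serves as the code of [a], as the size of a lone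
    player's group and as the membership mark. *)
Definition add_fan_cmd (x : nat) : cmd :=
  If 4
    (Read 9 x ;;
     If 9 skip
       (Pref 9 x 1 10 2 1 ;;
        If 9
          (Pref 9 x 2 1 1 10 ;;
           If 9 skip (Write x 1 ;; Defs.Sub 4 4 1))
          skip))
    skip.

Definition grow_cmd : cmd :=
  loop 7 (loop 8
    (Read 9 7 ;; If 9 (Edge 9 7 8 ;; If 9 (add_fan_cmd 8) skip) skip)).

Definition clear_cmd : cmd := loop 8 (Write 8 2).

Definition explore_cmd : cmd :=
  clear_cmd ;; Add 4 10 2 ;; add_fan_cmd 5 ;; loop 6 grow_cmd.

(** Register 4 doubles as a flag: it becomes 0 when an exploration succeeds, and later rounds then
    do nothing. The size is the counter plus 1, as the counter goes down to 0. If every exploration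
    failed, leftovers are cleared and everyone does nothing. *)
Definition search_cmd : cmd :=
  Const 4 1 ;;
  loop 3 (Add 10 3 1 ;; loop 5 (If 4 explore_cmd skip)) ;;
  If 4 clear_cmd skip.

(** * Correctness of the program *)

Section Correctness.

Variables (n : nat) (A : finType) (I : gGASP n A) (a : A).
Hypothesis A1 : #|A| = 1.

Lemma edge_queryE (i j : 'I_n) : edge_query I i j = edge I i j.
Proof.
apply/existsP/idP => [[i' /existsP[j' /and3P[/eqP/val_inj-> /eqP/val_inj->]]]//|ij].
by exists i; apply/existsP; exists j; rewrite !eqxx.
Qed.

Lemma act_code_inj : injective (@act_code A).
Proof. by move=> [x|] [y|] //= [] /ord_inj/enum_rank_inj->. Qed.

Lemma pref_queryE (i : 'I_n) x k y l :
    is_alternative n (x, k) -> is_alternative n (y, l) ->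
  pref_query I i (act_code x) k (act_code y) l = pref I i (x, k) (y, l).
Proof.
move=> xk yl; apply/existsP/idP => [[i' /existsP[x' /existsP[y']]]|p].
  by case/and5P=> /eqP/val_inj-> /eqP/act_code_inj-> /eqP/act_code_inj-> _ /andP[].
by exists i; apply/existsP; exists x; apply/existsP; exists y; rewrite !eqxx xk yl.
Qed.

Lemma act_code_single : act_code (Some a) = 1.
Proof. by congr _.+1; case: (enum_rank a) => m /=; rewrite A1; case: m. Qed.

Definition constants (s : state) : Prop :=
  [/\ reg s 0 = n, reg s 1 = 1 & reg s 2 = 0].

(** The bits serve directly as output, since [a] has code 1 and the void activity code 0. *)
Definition stored (S : {set 'I_n}) (s : state) : Prop :=
  forall i : 'I_n, memory s i = (i \in S).

Definition growing k (S : {set 'I_n}) (s : state) : Prop :=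
  [/\ reg s 4 = k - #|S|, #|S| <= k & stored S s].

Lemma wp_skip (Q : state -> Prop) s : Q (set_reg s 9 0) -> wp I skip Q s.
Proof. exact: wp_const. Qed.

Lemma wp_loop x c (Inv : nat -> state -> Prop) s :
    x \notin writes c -> ~~ has (mem (x :: writes c)) [:: 0; 1; 2] ->
    constants s ->
    (forall m s', m < n ->
       (forall y, y \notin x :: writes c -> reg s' y = reg s y) ->
       Inv m.+1 s' -> wp I c (Inv m) (set_reg s' x m)) ->
    Inv n (set_reg s x n) ->
  wp I (loop x c) (Inv 0) s.
Proof.
move=> xc /=; rewrite !inE !negb_or => /and4P[/andP[x0 _] /andP[x1 c1] _ _] [s0 s1 s2] body In.
apply: wp_seq; apply: wp_add; rewrite s0 s2 addn0.
apply: wp_for => //=; rewrite ?inE ?negb_or ?x1 ?c1 ?(negPf x1) ?eqxx //.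
move=> m s' mn fr; apply: body => // y yxc; rewrite fr //=.
by move: yxc; rewrite inE negb_or => /andP[/negPf->].
Qed.

(** Links countdown loops to the folds that model them. Register 4 is excluded as counter because
    [growing] constrains it. *)
Lemma wp_loop_foldl k x c (F : {set 'I_n} -> 'I_n -> {set 'I_n}) S s :
    x \notin 4 :: writes c -> ~~ has (mem (x :: writes c)) [:: 0; 1; 2] ->
    (forall (i : 'I_n) T s',
       (forall y, y \notin x :: writes c -> reg s' y = reg s y) ->
       reg s' x = i -> growing k T s' -> wp I c (growing k (F T i)) s') ->
    constants s -> growing k S s ->
  wp I (loop x c) (growing k (foldl F S (rev (enum 'I_n)))) s.
Proof.
rewrite inE negb_or eq_sym => /andP[/negPf x4 xc] c012 body sc sS.
(* The invariant looks ahead: folding over the [m] players still to come takes the current set to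
   the final one. *)
pose Inv m s' := exists2 T, growing k T s' &
  foldl F T (rev (take m (enum 'I_n))) = foldl F S (rev (enum 'I_n)).
apply: (@wp_mono _ _ _ _ (Inv 0)) => [s' [T sT /= eT]|].
  by move: sT; rewrite -eT take0.
apply: wp_loop => //.
  move=> m s' mn fr [T [r4 Tk mT] eT].
  apply: (wp_mono (Q := growing k (F T (Ordinal mn)))) => [s'' gs''|].
    exists (F T (Ordinal mn)) => //; rewrite -eT.
    rewrite (take_nth (Ordinal mn)) ?size_enum_ord // rev_rcons /=.
    by congr (foldl F (F T _) _); apply: val_inj; rewrite /= nth_enum_ord.
  apply: body; last by split; rewrite //= x4.
    by move=> y yxc; move: (yxc); rewrite inE negb_or /= => /andP[/negPf-> _]; rewrite fr.
  by rewrite /= eqxx.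
exists S; last by rewrite take_oversize // size_enum_ord.
by case: sS => r4 Sk mS; split; rewrite //= x4.
Qed.

Lemma wp_add_fan k S (j : 'I_n) x s :
    x \notin [:: 4; 9] -> 0 < k <= n -> constants s -> reg s 10 = k ->
    reg s x = j -> growing k S s ->
  wp I (add_fan_cmd x) (growing k (add_fan I a k S j)) s.
Proof.
rewrite !inE negb_or => /andP[/negPf x4 /negPf x9] kn [s0 s1 s2] sk sj [r4 Sk mS].
have altk : is_alternative n (Some a, k) by [].
have alt0 : @is_alternative n A (None, 1) by [].
have pref_fan := pref_queryE j altk alt0.
have pref_void := pref_queryE j alt0 altk.
rewrite act_code_single /= in pref_fan pref_void.
(* Four of the five branches write nothing but the scratch register; there [add_fan] must return
   [S]. *)
have keep T s' : T = S -> reg s' 4 = reg s 4 -> memory s' = memory s -> growing k T s'.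
  by move=> -> r4' m'; split; rewrite /stored ?r4' ?m'.
apply: wp_if => [|r0]; last first.
  by apply/wp_skip/keep => //; rewrite /add_fan; case: ifP => // /andP[]; lia.
rewrite r4 subn_eq0 -ltnNge => ltk.
apply/wp_seq/wp_read; apply: wp_if; rewrite /= sj mS.
  rewrite eqb0 negbK => jS; apply/wp_skip/keep => //.
  by rewrite /add_fan; case: ifP => // _; apply/setUidPr; rewrite sub1set.
move/eqP; rewrite eqb0 => jS.
have fanE : (j \in fans I a k) = spref I j (Some a, k) (None, 1) by rewrite inE.
apply/wp_seq/wp_pref; apply: wp_if; rewrite /= x9 sj s1 sk s2.
  rewrite pref_fan eqb0 negbK => p1.
  apply/wp_seq/wp_pref; apply: wp_if; rewrite /= x9 sj s1 sk s2.
    rewrite pref_void eqb0 negbK => p2.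
    by apply/wp_skip/keep => //; rewrite /add_fan fanE /spref p1 p2 andbF.
  move/eqP; rewrite pref_void eqb0 => p2.
  apply/wp_seq/wp_write/wp_sub; rewrite /add_fan ltk fanE /spref p1 p2 /= x9 s1 sj.
  split=> /=; rewrite ?cardsU1 ?jS //=; first by rewrite r4 -subnDA addnC.
  by move=> i /=; rewrite !inE mS -val_eqE; case: eqP.
move/eqP; rewrite pref_fan eqb0 => p1.
by apply/wp_skip/keep => //; rewrite /add_fan fanE /spref (negPf p1) andbF.
Qed.

Lemma wp_grow k S s :
    0 < k <= n -> constants s -> reg s 10 = k -> growing k S s ->
  wp I grow_cmd (growing k (grow I a k S)) s.
Proof.
move=> kn sc sk sS; apply: wp_loop_foldl => // i T s1 fr1 s1i s1T.
have sc1 : constants s1 by case: sc => ? ? ?; split; rewrite fr1.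
apply: wp_loop_foldl => // j U s2 fr2 s2j [r4 Uk mU].
have sc2 : constants s2 by case: sc1 => ? ? ?; split; rewrite fr2.
have s2i : reg s2 7 = i by rewrite fr2.
have s2k : reg s2 10 = k by rewrite fr2 // fr1.
rewrite /grow_along; apply/wp_seq/wp_read; apply: wp_if; rewrite /= s2i mU.
  rewrite eqb0 negbK => iU; rewrite iU; apply/wp_seq/wp_edge.
  rewrite /= s2i s2j edge_queryE; apply: wp_if; rewrite /=.
    by rewrite eqb0 negbK => ->; apply: wp_add_fan.
  by move/eqP; rewrite eqb0 => /negPf->; apply: wp_skip.
by move/eqP; rewrite eqb0 => /negPf->; apply: wp_skip.
Qed.

Lemma wp_clear s : constants s -> wp I clear_cmd (stored set0) s.
Proof.
move=> sc.
pose Inv m s' := forall i : 'I_n, m <= i -> memory s' i = 0.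
apply: (@wp_mono _ _ _ _ (Inv 0)) => [s' Is' i|]; first by rewrite Is' ?inE.
apply: wp_loop => // [m s' mn fr Im|i]; last by rewrite leqNgt ltn_ord.
apply: wp_write => i mi /=; rewrite fr //; case: sc => _ _ ->.
by case: eqP => // /eqP im; apply: Im; rewrite ltn_neqAle eq_sym im.
Qed.

Lemma wp_explore k (v : 'I_n) s :
    0 < k <= n -> constants s -> reg s 10 = k -> reg s 5 = v ->
  wp I explore_cmd (growing k (explore I a k v)) s.
Proof.
move=> kn sc sk sv; apply: wp_seq.
apply: wp_mono (wp_frame (wp_clear sc)) => s1 [s1S fr1].
apply/wp_seq/wp_add; rewrite !fr1 // sk; case: (sc) => s0 s1' s2; rewrite s2 addn0.
have sc1 : constants (set_reg s1 4 k) by split; rewrite /= fr1.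
have s1k : reg (set_reg s1 4 k) 10 = k by rewrite /= fr1.
apply: wp_seq; apply: wp_mono (wp_frame (@wp_add_fan k set0 v _ _ _ kn sc1 s1k _ _)) => //; first last.
- by split; rewrite /= ?cards0 ?subn0.
- by rewrite /= fr1.
move=> s2' [s2S fr2].
(* The rounds ignore the loop counter, so the iteration is recast as a fold over a list of length
   [n] to fit the loop rule. *)
have -> : explore I a k v =
    foldl (fun T _ => grow I a k T) (add_fan I a k set0 v) (rev (enum 'I_n)).
  have foldlE l S : iter (size l) (grow I a k) S =
      foldl (fun T (_ : 'I_n) => grow I a k T) S l.
    by elim: l S => //= i l IHl S; rewrite -IHl -iterSr.
  by rewrite -foldlE size_rev size_enum_ord.
have sc2 : constants s2' by case: sc1 => ? ? ?; split; rewrite fr2.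
apply: wp_loop_foldl => // i T s3 fr3 _ s3T.
apply: wp_grow => //; last by rewrite fr3 // fr2.
by case: sc2 => ? ? ?; split; rewrite fr3.
Qed.

Definition optimal (S : {set 'I_n}) : Prop :=
  viable I a S /\ forall T, viable I a T -> #|T| <= #|S|.

Definition found (s : state) : Prop :=
  reg s 4 = 0 /\ exists2 S, optimal S & stored S s.

Lemma wp_search s :
    constants s ->
  wp I search_cmd (fun s' => exists2 S, optimal S & stored S s') s.
Proof.
move=> sc; apply/wp_seq/wp_const; apply: wp_seq.
(* Unless a solution is already stored, all sizes above [m] have been ruled out. *)
pose bounded m s' := found s' \/
  reg s' 4 != 0 /\ forall T, viable I a T -> #|T| <= m.
have sc1 : constants (set_reg s 4 1) by case: sc.
suff : wp I (loop 3 (Add 10 3 1 ;; loop 5 (If 4 explore_cmd skip))) (bounded 0)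
    (set_reg s 4 1).
  move/wp_frame; apply: wp_mono => s' [bs' fr].
  have sc' : constants s' by case: sc1 => ? ? ?; split; rewrite fr.
  apply: wp_if => r4; last first.
    apply: wp_skip; case: bs' => [[_ [S]]|[]]; last by rewrite r4.
    by exists S.
  case: bs' => [[r0]|[_ T0]]; first by rewrite r0 in r4.
  apply: wp_mono (wp_clear sc') => s'' ms''; exists set0 => //.
  split; last by move=> T /T0; rewrite cards0.
  by split; rewrite ?sub0set // => x y; rewrite inE.
apply: wp_loop => //; last first.
  right; split=> // T _; rewrite -[leqRHS]card_ord; exact: max_card.
move=> m s' mn fr bs'; apply/wp_seq/wp_add.
have sc' : constants s' by case: sc1 => ? ? ?; split; rewrite fr.
set s2 := set_reg _ _ _.
have sc2 : constants s2 by [].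
have s2k : reg s2 10 = m.+1 by case: sc' => ? r1 ?; rewrite /= r1 addn1.
(* Every player from [v] on has failed as a start, so a viable coalition of size [m.+1] can only
   have members below [v]. *)
pose screened v s' := found s' \/ reg s' 4 != 0 /\
  forall T, viable I a T -> #|T| <= m.+1 /\
    (#|T| = m.+1 -> {in T, forall i : 'I_n, i < v}).
apply: (@wp_mono _ _ _ _ (screened 0)) => [s3 [f3|[r4 T0]]|].
- by left.
- right; split=> // T Tv; have [Tm T0'] := T0 _ Tv.
  rewrite leqNgt; apply/negP => mT.
  have /card_gt0P[i iT] : 0 < #|T| by lia.
  by have := T0' _ i iT; rewrite ltn0 => /(_ ltac:(lia)).
apply: wp_loop => //.
  move=> v s3 vn fr3 bs3; apply: wp_if => /= r4; last first.
    by apply: wp_skip; case: bs3 => [?|[]]; [left | rewrite r4].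
  case: bs3 => [[r0]|[_ Tv]]; first by rewrite r0 in r4.
  set s4 := set_reg _ _ _.
  have sc4 : constants s4 by case: sc2 => ? ? ?; split; rewrite /= fr3.
  have s4k : reg s4 10 = m.+1 by rewrite /= fr3.
  have s4v : reg s4 5 = Ordinal vn by [].
  have := @wp_explore m.+1 (Ordinal vn) s4 mn sc4 s4k s4v.
  apply: wp_mono => s5; set S := explore _ _ _ _ => -[r5 Sk mS].
  have [Sc Sf _] := explore_partial I a m.+1 (Ordinal vn).
  have [kS|Sltk] := leqP m.+1 #|S|.
    have eS : #|S| = m.+1 by lia.
    left; split; first by rewrite r5; lia.
    exists S => //; split; first by split; rewrite // eS.
    by move=> T /Tv[]; rewrite eS.
  right; split; first by rewrite r5; lia.
  move=> T Tvi; have [Tm Tlt] := Tv T Tvi; split=> // eT i iT.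
  have := Tlt eT i iT; rewrite ltnS leq_eqVlt => /predU1P[iv|//].
  have {}iv : i = Ordinal vn by apply: val_inj.
  (* A start inside a viable coalition of size [m.+1] would have succeeded. *)
  case: Tvi => Tc Tf; have := explore_complete Tc Tf iT (leqnn _).
  by rewrite eT iv leqNgt Sltk.
case: bs' => [[r0 ?]|[r4 Tm]]; first by left; split.
right; split=> // T /Tm lT; split=> // _ i _; exact: ltn_ord.
Qed.

Lemma search_outputs :
  exists pi : assignment n A,
    outputs_within I search_cmd (time_poly search_cmd).[n]%R pi /\ core_stable I pi.
Proof.
have [|t [s [tle run [S [Sv Smax] mS]]]] := @wp_search (init_state n A).
  by split; rewrite /= ?A1.
exists (coalition_assignment a S); split; last first.
  apply: core_stable_coalition => // b.
  by have /fintype_le1P/(_ a b) := eq_leq A1.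
(* A halted configuration is a fixed point of [step], so the run may be padded to the exact
   bound. *)
rewrite /outputs_within -(subnK tle) iterD run.
have -> d : iter d (step I) ([::], s) = ([::], s) by elim: d => //= d ->.
split=> // i; rewrite mS ffunE; case: ifP => // _.
by rewrite act_code_single.
Qed.

End Correctness.

Theorem proposition20 :
  (forall (n : nat) (A : finType) (I : gGASP n A),
     #|A| = 1 -> exists pi : assignment n A, core_stable I pi) /\
  (exists (prog : cmd) (p : {poly nat}),
     forall (n : nat) (A : finType) (I : gGASP n A),
       #|A| = 1 ->
       exists pi : assignment n A,
         outputs_within I prog (p.[n])%R pi /\ core_stable I pi).
Proof.
have main n A (I : gGASP n A) : #|A| = 1 -> exists pi : assignment n A,
    outputs_within I search_cmd (time_poly search_cmd).[n]%R pi /\ core_stable I pi.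
  move=> A1; have /card_gt0P[a _] : 0 < #|A| by rewrite A1.
  exact: search_outputs.
split; last by exists search_cmd, (time_poly search_cmd).
by move=> n A I A1; have [pi [_ ?]] := main n A I A1; exists pi.
Qed.
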